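(* If $\mathcal R\subseteq\mathcal T$ is an inclusion of operator systems, and if $\phi:\mathcal R\rightarrow\mathcal M$ is a pure completely positive linear map into an injective factor $\mathcal M$, then $\phi$ extends to a pure completely positive linear map $\Phi:\mathcal T\rightarrow\mathcal M$.
   Context: An operator system is a matrix-ordered complex $*$-vector space with a distinguished Archimedean (matrix) order unit; equivalently, up to unital complete order isomorphism, a unital selfadjoint linear subspace of $\mathcal B(\mathcal H)$ for some Hilbert space $\mathcal H$. In an inclusion $\mathcal R\subseteq\mathcal T$ of operator systems, $\mathcal R$ is an operator subsystem of $\mathcal T$ (same order unit, inherited matrix order). A factor is a von Neumann algebra with trivial centre; it is injective if it is injective as an operator system, i.e. for every inclusion $\mathcal R\subseteq\mathcal T$ of operator systems every completely positive linear map $\mathcal R\to\mathcal M$ extends to a completely positive linear map $\mathcal T\to\mathcal M$. For operator systems $\mathcal R,\mathcal Q$, $\mathcal{CP}(\mathcal R,\mathcal Q)$ is the convex cone of completely positive linear maps $\mathcal R\to\mathcal Q$. A completely positive map $\phi:\mathcal R\to\mathcal Q$ is pure if, whenever $\vartheta,\omega\in\mathcal{CP}(\mathcal R,\mathcal Q)$ satisfy $\vartheta+\omega=\phi$, there is $s\in[0,1]$ with $\vartheta=s\phi$ and $\omega=(1-s)\phi$. *)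

(* Defs.v *)
From HB Require Import structures.
From mathcomp Require Import all_boot all_order all_algebra.
From mathcomp Require Import sesquilinear complex.
From mathcomp Require Import all_classical all_reals topology normedtype.
From mathcomp Require Import ring lra.

Set Implicit Arguments.
Unset Strict Implicit.
Unset Printing Implicit Defensive.

Import Order.TTheory GRing.Theory Num.Theory.
Import numFieldNormedType.Exports.

Local Open Scope ring_scope.

(* Complex Hilbert spaces over R[i]; the inner product is linear in its first
   argument and induces the complete norm. *)
HB.mixin Record CompleteNormedModule_isHilbert (R : realType) H
    of CompleteNormedModule R[i] H := {
  dotp : {dot H for (@Num.conj R[i])};
  dotpE : forall x : H, dotp x x = `|x| ^+ 2
}.

#[short(type="hilbertType")]
HB.structure Definition Hilbert (R : realType) :=
  {H of CompleteNormedModule_isHilbert R H & CompleteNormedModule R[i] H}.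

Section Riesz.
Variables (R : realType) (H : hilbertType R).
Implicit Types (x y z w : H) (a : R[i]).

Lemma dotpC x y : dotp y x = (dotp x y)^*.
Proof. by rewrite hermC expr0 mul1r. Qed.

Lemma dotpDl x y z : dotp (x + y) z = dotp x z + dotp y z.
Proof. exact: linearDl. Qed.

Lemma dotpDr x y z : dotp x (y + z) = dotp x y + dotp x z.
Proof. exact: linearDr. Qed.

Lemma dotpZl a x y : dotp (a *: x) y = a * dotp x y.
Proof. exact: linearZl_LR. Qed.

Lemma dotpZr a x y : dotp x (a *: y) = a^* * dotp x y.
Proof. exact: linearZr_LR. Qed.

Lemma dotpNl x y : dotp (- x) y = - dotp x y.
Proof. exact: linearNl. Qed.

Lemma dotpNr x y : dotp x (- y) = - dotp x y.
Proof. exact: linearNr. Qed.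

Lemma dotp0l x : dotp 0 x = 0.
Proof. exact: linear0l. Qed.

Lemma dotp0r x : dotp x 0 = 0.
Proof. exact: linear0r. Qed.

Lemma dotp_suml I (r : seq I) (P : pred I) (F : I -> H) x :
  dotp (\sum_(i <- r | P i) F i) x = \sum_(i <- r | P i) dotp (F i) x.
Proof. exact: linear_sumlz. Qed.

Lemma dotp_sumr I (r : seq I) (P : pred I) (F : I -> H) x :
  dotp x (\sum_(i <- r | P i) F i) = \sum_(i <- r | P i) dotp x (F i).
Proof. exact: linear_sumr. Qed.

Lemma dotp_inj x y : (forall z, dotp z x = dotp z y) -> x = y.
Proof.
move=> xy; apply/eqP; rewrite -subr_eq0 -(dnorm_eq0 dotp).
by rewrite dotpDr dotpNr xy subrr.
Qed.

(* The squared norm of x, as an element of R instead of R[i]. *)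
Definition sqn x : R := complex.Re (dotp x x).

Lemma ReD a b : complex.Re (a + b) = complex.Re a + complex.Re b.
Proof. by case: a b => [? ?] [? ?]. Qed.

Lemma ReN a : complex.Re (- a) = - complex.Re a.
Proof. by case: a. Qed.

Lemma Re_conj a : complex.Re a^* = complex.Re a.
Proof. by case: a. Qed.

Lemma ReZ (t : R) a : complex.Re (real_complex R t * a) = t * complex.Re a.
Proof. by case: a => u v /=; rewrite mul0r subr0. Qed.

Lemma ge0_ReE a : 0 <= a -> a = real_complex R (complex.Re a).
Proof. by move=> /ger0_real /RRe_real. Qed.

Lemma sqnE x : dotp x x = real_complex R (sqn x).
Proof. exact/ge0_ReE/dnorm_ge0. Qed.

Lemma sqn_ge0 x : 0 <= sqn x.
Proof. by rewrite -(@lecR R) -sqnE dnorm_ge0. Qed.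

Lemma sqn0_eq0 x : sqn x = 0 -> x = 0.
Proof. by move=> x0; apply/eqP; rewrite -(dnorm_eq0 dotp) sqnE x0. Qed.

Lemma sqnD x y : sqn (x + y) = sqn x + 2 * complex.Re (dotp x y) + sqn y.
Proof.
by rewrite /sqn !dotpDl !dotpDr !ReD (dotpC x y) Re_conj mulr_natl mulr2n !addrA.
Qed.

Lemma sqnN x : sqn (- x) = sqn x.
Proof. by rewrite /sqn dotpNl dotpNr opprK. Qed.

Lemma sqnZ (t : R) x : sqn (real_complex R t *: x) = t ^+ 2 * sqn x.
Proof.
have tc : (real_complex R t)^* = real_complex R t by exact: conjc_real.
by rewrite /sqn dotpZl dotpZr tc !ReZ mulrA.
Qed.

Lemma discr_le (g n d : R) : 0 <= n ->
  (forall t : R, - d <= 2 * (t * g) + t ^+ 2 * n) -> g ^+ 2 <= d * n.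
Proof.
move=> n0 gd; have [n1|] := ltP 0 n.
  have := gd (- g / n).
  have -> : 2 * (- g / n * g) + (- g / n) ^+ 2 * n = - (g ^+ 2 / n).
    by field; rewrite gt_eqF.
  by rewrite lerN2 ler_pdivrMr.
move=> nle; have {nle n0}nE : n = 0 by apply/le_anti/andP.
rewrite nE mulr0; have {nE}gd t : - d <= 2 * (t * g).
  by have := gd t; rewrite nE mulr0 addr0.
have [->|g0] := eqVneq g 0; first by rewrite expr0n.
exfalso; have := gd ((- d - 1) / (2 * g)).
by rewrite (_ : 2 * _ = - d - 1); [lra | field].
Qed.

Lemma Re_dotp_le x y : (complex.Re (dotp x y)) ^+ 2 <= sqn x * sqn y.
Proof.
apply: discr_le (sqn_ge0 _) _ => t.
have := sqn_ge0 (x + real_complex R t *: y).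
by rewrite sqnD sqnZ dotpC dotpZl Re_conj ReZ dotpC Re_conj; lra.
Qed.

Lemma sqn_normE x : `|x| ^+ 2 = real_complex R (sqn x).
Proof. by rewrite -dotpE sqnE. Qed.

Lemma riesz (f : H -> R[i]) (K : R) :
  (forall a x y, f (a *: x + y) = a * f x + f y) ->
  (forall x, complex.Re (f x) ^+ 2 <= K * sqn x) ->
  exists z, forall x, f x = dotp x z.
Proof.
move=> fL fK.
have K0 : 0 <= K \/ forall x, sqn x = 0.
  have [|K0] := leP 0 K; [by left|right=> x].
  apply/eqP; rewrite eq_le sqn_ge0 andbT -(nmulr_rge0 _ K0).
  exact: le_trans (sqr_ge0 _) (fK x).
have f0 : f 0 = 0.
  by have := fL (-1) 0 0; rewrite scaler0 addr0 mulN1r addNr.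
have fD x y : f (x + y) = f x + f y.
  by have := fL 1 x y; rewrite scale1r mul1r.
have fZ a x : f (a *: x) = a * f x.
  by have := fL a x 0; rewrite addr0 f0 addr0.
case: K0 => [K0|H0]; last first.
  exists 0 => x; rewrite dotp0r (_ : x = 0) ?f0//.
  exact/sqn0_eq0.
pose F x := sqn x - 2 * complex.Re (f x).
have F_lb x : - K <= F x.
  rewrite leNgt; apply/negP; rewrite /F.
  have := fK x; have := sqn_ge0 x.
  set s := sqn x; set r := complex.Re (f x) => s0 rK Flt.
  have : 0 < (2 * r - s - K) * (2 * r + s + K) by apply: mulr_gt0; lra.
  have := sqr_ge0 (s - K); move: rK; rewrite !expr2; lra.
pose m := inf (range F).
have F_inf : has_inf (range F).
  by split; [exists (F 0); exists 0|exists (- K) => _ [x _ <-]].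
have mF x : m <= F x by apply: ge_inf; [case: F_inf|exists x].
have F_shift x w (t : R) : F (x + real_complex R t *: w) =
    F x + 2 * (t * (complex.Re (dotp w x) - complex.Re (f w))) + t ^+ 2 * sqn w.
  rewrite /F sqnD sqnZ fD fZ ReD ReZ dotpC dotpZl Re_conj ReZ; lra.
have F_para x y : sqn (x - y) = 2 * F x + 2 * F y
    - 4 * F (real_complex R (2^-1) *: (x + y)).
  rewrite /F sqnZ fZ ReZ fD ReD !sqnD sqnN dotpNr ReN.
  by field.
pose A (e : R) := [set x | F x < m + e]%classic.
pose G := filter_from [set e : R | 0 < e]%classic A.
have A_neq0 e : 0 < e -> exists x, A e x.
  by move=> e0; have [_ [x _ <-] Fx] := inf_adherent e0 F_inf; exists x.
have G_filter : ProperFilter G.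
  apply: filter_from_proper => //; apply: filter_from_filter.
    by exists 1 => /=.
  move=> d e /= d0 e0; exists (Num.min d e); first by rewrite /= lt_min d0.
  by move=> x; rewrite /A/=; case: (ltP d e) => ? ?; split => /=; lra.
have G_cauchy : cauchy G.
  apply: cauchy_exP => e e0; rewrite /cauchy_ex.
  have eR := ge0_ReE (ltW e0); set d := complex.Re e in eR.
  have d0 : 0 < d by rewrite -(@ltcR R) -eR.
  have [x Ax] := A_neq0 (d ^+ 2 / 4) ltac:(by rewrite divr_gt0// exprn_gt0).
  exists x; exists (d ^+ 2 / 4); first by rewrite /= divr_gt0// exprn_gt0.
  move=> y Ay; rewrite -ball_normE /ball_/=.
  rewrite -(@ltr_pXn2r _ 2)// ?nnegrE ?normr_ge0 ?(ltW e0)//.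
  rewrite sqn_normE eR -rmorphXn/= ltcR F_para.
  have := mF (real_complex R 2^-1 *: (x + y)); move: Ax Ay.
  by rewrite /A/=; lra.
have [z Gz] : exists z, (G --> z)%classic.
  exists (lim G); apply: cauchy_cvg G_cauchy.
exists z.
have Ref w : complex.Re (dotp w z) = complex.Re (f w).
  apply/eqP; rewrite -subr_eq0 -sqrf_eq0 eq_le sqr_ge0 andbT.
  set g := complex.Re (dotp w z) - complex.Re (f w).
  suff g_le (d : R) : 0 < d -> g ^+ 2 <= d * (4 * sqn w).
    apply/ler_addgt0Pl => e e0; rewrite addr0.
    have n0 : 0 < 4 * sqn w + 1 by have := sqn_ge0 w; lra.
    apply: (le_trans (g_le (e / (4 * sqn w + 1)) _)); first by rewrite divr_gt0.
    by rewrite mulrAC ler_pdivrMr//; nra.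
  move=> d0.
  have [x [Ax zx]] : exists x, A d x /\ sqn (z - x) < d.
    have : G (A d `&` [set x | sqn (z - x) < d])%classic.
      apply: filterI; first by exists d.
      apply: Gz; apply/nbhs_normP; exists (real_complex R (Num.sqrt d)).
        by rewrite /= ltcR sqrtr_gt0.
      move=> x /=; rewrite -(@ltr_pXn2r _ 2)// ?nnegrE ?lecR ?sqrtr_ge0//.
      by rewrite sqn_normE -rmorphXn/= ltcR sqr_sqrtr// ltW.
    by move=> /filter_ex[x []]; exists x.
  have g1 : (complex.Re (dotp w x) - complex.Re (f w)) ^+ 2 <= d * sqn w.
    apply: discr_le (sqn_ge0 _) _ => t; have := mF (x + real_complex R t *: w).
    by rewrite F_shift; move: Ax; rewrite /A/=; lra.
  have g2 := Re_dotp_le w (z - x).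
  have gE : g = (complex.Re (dotp w x) - complex.Re (f w))
                + complex.Re (dotp w (z - x)).
    by rewrite dotpDr dotpNr ReD ReN /g; lra.
  have n0 := sqn_ge0 w; have dn : sqn w * sqn (z - x) <= sqn w * d.
    by rewrite ler_wpM2l// ltW.
  move: g1 g2 dn n0; rewrite gE.
  set a := complex.Re _ - _; set b := complex.Re _ => g1 g2 dn n0.
  by have := sqr_ge0 (a - b); move: g1 g2; rewrite !expr2; lra.
move=> w; have := Ref w; have := Ref ('i%C *: w).
rewrite dotpZl fZ; case: (dotp w z) (f w) => [u v] [u' v'] /=.
by rewrite !mul0r !mul1r !sub0r => /oppr_inj -> ->.
Qed.
End Riesz.

(* In R[i] the relation 0 <= a means that a is a nonnegative real number, so
   r and a below range over real scalars.  The matrix size n = 0 is allowed;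
   'M_0 has a single element, which is positive.  In
   mpos_compress the matrix is A^* X A; in the last two axioms (r *: ounit)%:M
   is the diagonal matrix r e_n. *)
HB.mixin Record Lmodule_isOperatorSystem (R : realType) V
    of GRing.Lmodule R[i] V := {
  star : V -> V;
  ounit : V;
  mpos : forall n, 'M[V]_n -> Prop;
  starK : involutive star;
  star_semilinear : forall (a : R[i]) (u v : V),
    star (a *: u + v) = a^* *: star u + star v;
  mpos_herm : forall n (X : 'M[V]_n), mpos _ X -> (map_mx star X)^T = X;
  mpos0 : forall n, mpos n 0;
  mposD : forall n (X Y : 'M[V]_n), mpos _ X -> mpos _ Y -> mpos _ (X + Y);
  mposZ : forall n (a : R[i]) (X : 'M[V]_n),
    0 <= a -> mpos _ X -> mpos _ (map_mx ( *:%R a) X);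
  mpos_proper : forall n (X : 'M[V]_n), mpos _ X -> mpos _ (- X) -> X = 0;
  mpos_compress : forall n m (A : 'M[R[i]]_(n, m)) (X : 'M[V]_n), mpos _ X ->
    mpos _ (\matrix_(i < m, j < m)
            \sum_(k < n) \sum_(l < n) ((A k i)^* * A l j) *: X k l);
  ounit_order_unit : forall n (X : 'M[V]_n), (map_mx star X)^T = X ->
    exists2 r : R[i], 0 < r & mpos _ ((r *: ounit)%:M - X);
  ounit_archimedean : forall n (X : 'M[V]_n),
    (forall r : R[i], 0 < r -> mpos _ ((r *: ounit)%:M + X)) -> mpos _ X
}.

#[short(type="operatorSystemType")]
HB.structure Definition OperatorSystem (R : realType) :=
  {V of Lmodule_isOperatorSystem R V & GRing.Lmodule R[i] V}.
Section BoundedOperators.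
Variables (R : realType) (H : hilbertType R).

Definition boundedOp_pred : {pred H -> H} :=
  fun T => `[< linear T /\ continuous T >].

Record boundedOp := BoundedOp {
  boundedOp_fun :> H -> H;
  boundedOpP : boundedOp_fun \in boundedOp_pred
}.

HB.instance Definition _ := [isSub for boundedOp_fun].
HB.instance Definition _ := [Choice of boundedOp by <:].

Lemma boundedOp_pred_submod_closed : submod_closed boundedOp_pred.
Proof.
split=> [|a f g]; rewrite !unfold_in.
  apply/asboolP; split=> [b u v|x] /=; first by rewrite scaler0 addr0.
  exact: cst_continuous.
move=> /asboolP[fL fC] /asboolP[gL gC]; apply/asboolP; split=> [b u v|x] /=.
  rewrite !fctE fL gL !scalerDr !scalerA (mulrC a b) -!addrA; congr (_ + _).
  by rewrite addrCA.
by apply: cvgD; [apply: cvgZr; exact: fC|exact: gC].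
Qed.

HB.instance Definition _ := GRing.isSubmodClosed.Build _ _ boundedOp_pred
  boundedOp_pred_submod_closed.
HB.instance Definition _ := [SubChoice_isSubLmodule of boundedOp by <:].

Implicit Types (S T : boundedOp).

Lemma boundedOp_linear T : linear T.
Proof. by have /asboolP[] := boundedOpP T. Qed.

HB.instance Definition _ T :=
  GRing.isLinear.Build R[i] H H _ T (boundedOp_linear T).

Lemma boundedOp_continuous T : continuous T.
Proof. by have /asboolP[] := boundedOpP T. Qed.

Lemma boundedOp_eq S T : S =1 T -> S = T.
Proof. by move=> ST; apply/val_inj/funext. Qed.

Lemma boundedOp_sqn_le T : exists2 K : R, 0 <= K & forall x, sqn (T x) <= K * sqn x.
Proof.
have := @continuous_linear_bounded _ _ _ 0 T (@boundedOp_continuous T 0).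
move=> /linear_boundedP/pinfty_ex_gt0[r r0 Tr].
have rE := ge0_ReE (ltW r0).
exists (complex.Re r ^+ 2) => [|x]; first exact: sqr_ge0.
rewrite -(@lecR R) rmorphM rmorphXn/= -rE -!sqn_normE -exprMn.
have rx : 0 <= r * `|x| by rewrite mulr_ge0// ltW.
by rewrite ler_pXn2r ?nnegrE ?normr_ge0 ?Tr.
Qed.

Lemma linear_sqn_boundedOp (T : H -> H) (K : R) : linear T -> 0 <= K ->
  (forall x, sqn (T x) <= K * sqn x) -> T \in boundedOp_pred.
Proof.
move=> TL K0 TK; apply/asboolP; split=> //.
pose Tl : {linear H -> H} := HB.pack T (GRing.isLinear.Build R[i] H H _ T TL).
apply: (@bounded_linear_continuous _ _ _ Tl); apply/linear_boundedP.
near=> r => x /=.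
have r0 : 0 <= r by near: r; exact: nbhs_pinfty_ge.
have Kr : real_complex R (Num.sqrt K) <= r.
  by near: r; apply: nbhs_pinfty_ge; rewrite ger0_real// lecR sqrtr_ge0.
apply: (@le_trans _ _ (real_complex R (Num.sqrt K) * `|x|)); last first.
  by rewrite ler_wpM2r.
rewrite -(@ler_pXn2r _ 2)// ?nnegrE ?normr_ge0 ?mulr_ge0 ?lecR ?sqrtr_ge0//.
by rewrite exprMn !sqn_normE -rmorphXn/= sqr_sqrtr// -rmorphM/= lecR.
Unshelve. all: by end_near. Qed.

Lemma boundedOp_adjoint T : exists S, forall x y, dotp (T x) y = dotp x (S y).
Proof.
have [K K0 TK] := boundedOp_sqn_le T.
have ex y : exists z, forall x, dotp (T x) y = dotp x z.
  apply: (@riesz _ _ _ (K * sqn y)) => [a u v|x].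
    by rewrite linearP dotpDl dotpZl.
  apply: le_trans (Re_dotp_le _ _) _; rewrite mulrAC.
  by rewrite ler_wpM2r// sqn_ge0.
have {ex}[S TS] := choice ex.
suff Sb : S \in boundedOp_pred by exists (BoundedOp Sb) => x y; exact: TS.
apply: (linear_sqn_boundedOp _ K0) => [a u v|y].
  by apply: dotp_inj => z; rewrite -TS !(dotpDr, dotpZr) !TS.
have Sy : sqn (S y) ^+ 2 <= K * sqn (S y) * sqn y.
  have -> : sqn (S y) = complex.Re (dotp (T (S y)) y) by rewrite TS.
  apply: le_trans (Re_dotp_le _ _) _; rewrite ler_wpM2r ?sqn_ge0//.
  by rewrite TS; exact: TK.
have [y0|y0] := ltP 0 (sqn (S y)); last by rewrite (le_trans y0)// mulr_ge0// sqn_ge0.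
by rewrite -(ler_pM2l y0) -expr2 mulrCA mulrA.
Qed.

Definition bopadj T : boundedOp := projT1 (cid (boundedOp_adjoint T)).

Lemma bopadjE T x y : dotp (T x) y = dotp x (bopadj T y).
Proof. by rewrite /bopadj; case: cid. Qed.

Lemma bopadjE' T x y : dotp (bopadj T x) y = dotp x (T y).
Proof. by rewrite dotpC -bopadjE -dotpC. Qed.

Lemma id_boundedOp : (@idfun H) \in boundedOp_pred.
Proof. by apply/asboolP; split=> // x; exact: cvg_id. Qed.

Definition bop1 : boundedOp := BoundedOp id_boundedOp.

Lemma boundedOpDE S T x : (S + T) x = S x + T x. Proof. by []. Qed.
Lemma boundedOpZE (a : R[i]) T x : (a *: T) x = a *: T x. Proof. by []. Qed.
Lemma boundedOpNE T x : (- T) x = - T x. Proof. by []. Qed.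
Lemma boundedOp0E x : (0 : boundedOp) x = 0. Proof. by []. Qed.

Lemma boundedOp_sumE I (r : seq I) (P : pred I) (F : I -> boundedOp) x :
  (\sum_(i <- r | P i) F i) x = \sum_(i <- r | P i) F i x.
Proof. by elim/big_rec2: _ => //= i u v _ <-. Qed.

Lemma bopadjK : involutive bopadj.
Proof.
move=> T; apply: boundedOp_eq => x; apply: dotp_inj => z.
by rewrite -bopadjE bopadjE'.
Qed.

Lemma bopadj_semilinear (a : R[i]) S T :
  bopadj (a *: S + T) = a^* *: bopadj S + bopadj T.
Proof.
apply: boundedOp_eq => x; apply: dotp_inj => z.
by rewrite -bopadjE !(boundedOpDE, boundedOpZE) !(dotpDl, dotpZl, dotpDr, dotpZr)
  conjCK !bopadjE.
Qed.

(* The sesquilinear form of the operator with matrix entries X i j acting on the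
   n-fold direct sum of H.  A bounded operator on a complex Hilbert space is
   positive when its quadratic form is nonnegative, so bop_mpos is positivity
   of that operator. *)
Definition mxform n (X : 'M[boundedOp]_n) (u v : 'I_n -> H) : R[i] :=
  \sum_i \sum_j dotp (X i j (u j)) (v i).

Definition bop_mpos n (X : 'M[boundedOp]_n) : Prop :=
  forall u : 'I_n -> H, 0 <= mxform X u u.

Lemma mxformDl n X (u v w : 'I_n -> H) :
  mxform X (u + v) w = mxform X u w + mxform X v w.
Proof.
rewrite /mxform -big_split; apply: eq_bigr => i _ /=.
by rewrite -big_split; apply: eq_bigr => j _ /=; rewrite fctE linearD dotpDl.
Qed.

Lemma mxformDr n X (u v w : 'I_n -> H) :
  mxform X w (u + v) = mxform X w u + mxform X w v.
Proof.
rewrite /mxform -big_split; apply: eq_bigr => i _ /=.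
by rewrite -big_split; apply: eq_bigr => j _ /=; rewrite fctE dotpDr.
Qed.

Lemma mxformZl n X a (u v : 'I_n -> H) :
  mxform X (fun i => a *: u i) v = a * mxform X u v.
Proof.
rewrite /mxform mulr_sumr; apply: eq_bigr => i _ /=.
by rewrite mulr_sumr; apply: eq_bigr => j _ /=; rewrite linearZ dotpZl.
Qed.

Lemma mxformZr n X a (u v : 'I_n -> H) :
  mxform X u (fun i => a *: v i) = a^* * mxform X u v.
Proof.
rewrite /mxform mulr_sumr; apply: eq_bigr => i _ /=.
by rewrite mulr_sumr; apply: eq_bigr => j _ /=; rewrite dotpZr.
Qed.

Lemma mxform_add n (X Y : 'M[boundedOp]_n) (u v : 'I_n -> H) :
  mxform (X + Y) u v = mxform X u v + mxform Y u v.
Proof.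
rewrite /mxform -big_split; apply: eq_bigr => i _ /=.
by rewrite -big_split; apply: eq_bigr => j _ /=; rewrite mxE boundedOpDE dotpDl.
Qed.

Lemma mxform_opp n (X : 'M[boundedOp]_n) (u v : 'I_n -> H) :
  mxform (- X) u v = - mxform X u v.
Proof.
rewrite /mxform -sumrN; apply: eq_bigr => i _ /=.
by rewrite -sumrN; apply: eq_bigr => j _ /=; rewrite mxE boundedOpNE dotpNl.
Qed.

Lemma mxform_scale n a (X : 'M[boundedOp]_n) (u v : 'I_n -> H) :
  mxform (map_mx ( *:%R a) X) u v = a * mxform X u v.
Proof.
rewrite /mxform mulr_sumr; apply: eq_bigr => i _ /=.
by rewrite mulr_sumr; apply: eq_bigr => j _ /=; rewrite mxE boundedOpZE dotpZl.
Qed.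

Lemma mxform_adj n (X : 'M[boundedOp]_n) (u v : 'I_n -> H) :
  mxform (map_mx bopadj X)^T u v = (mxform X v u)^*.
Proof.
rewrite /mxform exchange_big rmorph_sum; apply: eq_bigr => i _ /=.
by rewrite rmorph_sum; apply: eq_bigr => j _ /=; rewrite !mxE bopadjE' dotpC.
Qed.

Lemma mxform_unit n (r : R) (u : 'I_n -> H) :
  mxform (real_complex R r *: bop1)%:M u u = real_complex R (r * \sum_i sqn (u i)).
Proof.
rewrite rmorphM rmorph_sum/= mulr_sumr; apply: eq_bigr => i _ /=.
rewrite (bigD1 i)//= mxE eqxx mulr1n boundedOpZE dotpZl /= sqnE.
rewrite big1 ?addr0// => j ji; rewrite mxE eq_sym (negbTE ji) mulr0n.
by rewrite boundedOp0E dotp0l.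
Qed.

Lemma mxform_eq0 n (X : 'M[boundedOp]_n) :
  (forall u : 'I_n -> H, mxform X u u = 0) -> X = 0.
Proof.
move=> X0.
have X0' (u v : 'I_n -> H) : mxform X u v = 0.
  have XD (a b : 'I_n -> H) : mxform X a b + mxform X b a = 0.
    have := X0 (a + b); rewrite mxformDl !mxformDr !X0 add0r addr0.
    by rewrite addrC => <-; rewrite addrC.
  have h1 := XD u v; have := XD u (fun i => 'i *: v i).
  rewrite mxformZl mxformZr conjCi mulNr addrC -mulrBr => /eqP.
  rewrite mulf_eq0 (negbTE (neq0Ci _)) /= subr_eq0 => /eqP vu.
  by apply/eqP; move/eqP: h1; rewrite vu -mulr2n mulrn_eq0.
apply/matrixP => i j; rewrite mxE; apply: boundedOp_eq => x.
apply/eqP; rewrite boundedOp0E -(dnorm_eq0 dotp); apply/eqP.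
rewrite -[RHS](X0' (fun k => if k == j then x else 0)
                   (fun k => if k == i then X i j x else 0)).
rewrite /mxform (bigD1 i)//= (bigD1 j)//= !eqxx big1 => [|k /negbTE->]; last first.
  by rewrite linear0 dotp0l.
rewrite big1 ?addr0// => k /negbTE ->; rewrite big1// => l _.
by rewrite dotp0r.
Qed.

Lemma bop_mpos_herm n (X : 'M[boundedOp]_n) :
  bop_mpos X -> (map_mx bopadj X)^T = X.
Proof.
move=> X0; apply/eqP; rewrite -subr_eq0; apply/eqP/mxform_eq0 => u.
by rewrite mxform_add mxform_opp mxform_adj conj_Creal ?subrr// ger0_real.
Qed.

Lemma bop_mpos0 n : @bop_mpos n 0.
Proof.
move=> u; rewrite /mxform big1// => i _.
by rewrite big1// => j _; rewrite mxE boundedOp0E dotp0l.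
Qed.

Lemma bop_mposD n (X Y : 'M[boundedOp]_n) :
  bop_mpos X -> bop_mpos Y -> bop_mpos (X + Y).
Proof. by move=> X0 Y0 u; rewrite mxform_add addr_ge0. Qed.

Lemma bop_mposZ n (a : R[i]) (X : 'M[boundedOp]_n) :
  0 <= a -> bop_mpos X -> bop_mpos (map_mx ( *:%R a) X).
Proof. by move=> a0 X0 u; rewrite mxform_scale mulr_ge0. Qed.

Lemma bop_mpos_proper n (X : 'M[boundedOp]_n) :
  bop_mpos X -> bop_mpos (- X) -> X = 0.
Proof.
move=> X0 NX0; apply: mxform_eq0 => u; apply/le_anti.
by rewrite X0 andbT -oppr_ge0 -mxform_opp NX0.
Qed.

Lemma bop_mpos_compress n m (A : 'M[R[i]]_(n, m)) (X : 'M[boundedOp]_n) :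
  bop_mpos X ->
  bop_mpos (\matrix_(i < m, j < m)
    \sum_(k < n) \sum_(l < n) ((A k i)^* * A l j) *: X k l).
Proof.
move=> X0 u; rewrite (_ : mxform _ u u =
  mxform X (fun k => \sum_i A k i *: u i) (fun k => \sum_i A k i *: u i)) //.
transitivity (\sum_i \sum_j \sum_k \sum_l
    (A k i)^* * A l j * dotp (X k l (u j)) (u i)).
  apply: eq_bigr => i _; apply: eq_bigr => j _.
  rewrite mxE boundedOp_sumE dotp_suml; apply: eq_bigr => k _.
  rewrite boundedOp_sumE dotp_suml; apply: eq_bigr => l _.
  by rewrite boundedOpZE dotpZl.
transitivity (\sum_k \sum_l \sum_j \sum_i
    (A k i)^* * A l j * dotp (X k l (u j)) (u i)); last first.
  apply: eq_bigr => k _; apply: eq_bigr => l _.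
  rewrite [X k l _]linear_sum dotp_suml; apply: eq_bigr => j _ /=.
  rewrite [X k l (_ *: _)]linearZ_LR /= dotpZl dotp_sumr mulr_sumr; apply: eq_bigr => i _.
  by rewrite dotpZr mulrA [X in X * _]mulrC.
under eq_bigr => i _ do rewrite exchange_big.
rewrite exchange_big; apply: eq_bigr => k _ /=.
under eq_bigr => i _ do rewrite exchange_big.
rewrite exchange_big; apply: eq_bigr => l _ /=.
by rewrite exchange_big.
Qed.

Lemma mxform_ge n (X : 'M[boundedOp]_n) : exists2 K : R, 0 <= K &
  forall u : 'I_n -> H, complex.Re (mxform X u u) <= K * \sum_i sqn (u i).
Proof.
have KX (p : 'I_n * 'I_n) : exists K : R,
    0 <= K /\ forall x, sqn (X p.1 p.2 x) <= K * sqn x.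
  by have [K K0 XK] := boundedOp_sqn_le (X p.1 p.2); exists K.
have [K KP] := choice KX; have K0 p : 0 <= K p by case: (KP p).
have XK p x : sqn (X p.1 p.2 x) <= K p * sqn x by case: (KP p).
exists (\sum_p (K p + 1)) => [|u].
  by apply: sumr_ge0 => p _; rewrite addr_ge0.
rewrite mulr_suml /mxform pair_big/=.
have ReS (F : 'I_n * 'I_n -> R[i]) :
    complex.Re (\sum_p F p) = \sum_p complex.Re (F p).
  by apply: (big_morph (@complex.Re R) (@ReD R) (erefl : complex.Re 0 = 0)).
rewrite ReS; apply: ler_sum => -[i j] _ /=.
have s_ge k : sqn (u k) <= \sum_l sqn (u l).
  by rewrite (bigD1 k)//= lerDl sumr_ge0// => l _; exact: sqn_ge0.
have h1 := XK (i, j) (u j); have h2 := sqn_ge0 (X i j (u j) - u i).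
rewrite sqnD sqnN dotpNr ReN in h2.
have h3 : K (i, j) * sqn (u j) <= K (i, j) * \sum_l sqn (u l).
  by rewrite ler_wpM2l.
have h4 := s_ge i; rewrite /= in h1; have h5 := sqn_ge0 (u i).
have h6 : 0 <= K (i, j) * \sum_l sqn (u l).
  by rewrite mulr_ge0// sumr_ge0// => l _; exact: sqn_ge0.
rewrite mulrDl mul1r; lra.
Qed.

Lemma bop1_order_unit n (X : 'M[boundedOp]_n) : (map_mx bopadj X)^T = X ->
  exists2 r : R[i], 0 < r & bop_mpos ((r *: bop1)%:M - X).
Proof.
move=> XX; have [K K0 XK] := mxform_ge X.
exists (real_complex R (K + 1)); first by rewrite ltcR ltr_wpDl.
move=> u; rewrite mxform_add mxform_opp mxform_unit.
have uX : (mxform X u u)^* = mxform X u u by rewrite -mxform_adj XX.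
have Xr : mxform X u u \is Num.real by apply/CrealP.
rewrite -(RRe_real Xr) -rmorphB/= lecR subr_ge0 (le_trans (XK u))//.
rewrite ler_wpM2r ?lerDl// sumr_ge0// => i _; exact: sqn_ge0.
Qed.

Lemma bop1_archimedean n (X : 'M[boundedOp]_n) :
  (forall r : R[i], 0 < r -> bop_mpos ((r *: bop1)%:M + X)) -> bop_mpos X.
Proof.
move=> X0 u; have S0 : 0 <= \sum_i sqn (u i).
  by rewrite sumr_ge0// => i _; exact: sqn_ge0.
have X0' (r : R) : 0 < r ->
    0 <= real_complex R (r * \sum_i sqn (u i)) + mxform X u u.
  move=> r0; rewrite -mxform_unit -mxform_add; apply: X0.
  by rewrite ltcR.
have Xr : mxform X u u \is Num.real.
  have := ger0_real (X0' 1 ltr01).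
  by rewrite rpredDl//; apply/complex_realP; exists (1 * \sum_i sqn (u i)).
rewrite -(RRe_real Xr) ler0c; apply/ler_addgt0Pl => e e0.
have n0 : 0 < \sum_i sqn (u i) + 1 by rewrite ltr_wpDl.
have /X0' : 0 < e / (\sum_i sqn (u i) + 1) by rewrite divr_gt0.
rewrite -(RRe_real Xr) -rmorphD/= lecR => /le_trans; apply.
rewrite lerD2r mulrAC ler_pdivrMr// ler_pM2l//; lra.
Qed.

HB.instance Definition _ := Lmodule_isOperatorSystem.Build R boundedOp
  bopadjK bopadj_semilinear bop_mpos_herm bop_mpos0 bop_mposD bop_mposZ
  bop_mpos_proper bop_mpos_compress bop1_order_unit bop1_archimedean.

End BoundedOperators.

(* A unital selfadjoint linear subspace; it becomes an operator system with the
   inherited order unit and matrix cones (subsystemType below). *)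
Record opSubsystem (R : realType) (T : operatorSystemType R) := OpSubsystem {
  subsystem_pred : {pred T};
  subsystem_submod : submod_closed subsystem_pred;
  subsystem_star : {in subsystem_pred, forall x, star x \in subsystem_pred};
  subsystem_unit : ounit \in subsystem_pred
}.

Section Subsystem.
Variables (R : realType) (T : operatorSystemType R) (S : opSubsystem T).

Record subsystemType := SubsystemType {
  subsystem_val : T;
  subsystem_valP : subsystem_val \in subsystem_pred S
}.

HB.instance Definition _ := [isSub for subsystem_val].
HB.instance Definition _ := [Choice of subsystemType by <:].
HB.instance Definition _ := GRing.isSubmodClosed.Build _ _ (subsystem_pred S)
  (subsystem_submod S).
HB.instance Definition _ := [SubChoice_isSubLmodule of subsystemType by <:].

Implicit Types (x y : subsystemType).

Definition sub_star x : subsystemType :=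
  SubsystemType (subsystem_star (subsystem_valP x)).

Definition sub_unit : subsystemType := SubsystemType (subsystem_unit S).

Definition sub_mpos n (X : 'M[subsystemType]_n) : Prop :=
  mpos n (map_mx val X).

Lemma sub_starK : involutive sub_star.
Proof. by move=> x; apply: val_inj; exact: starK. Qed.

Lemma sub_star_semilinear (a : R[i]) x y :
  sub_star (a *: x + y) = a^* *: sub_star x + sub_star y.
Proof. by apply: val_inj; exact: star_semilinear. Qed.

Lemma map_mx_val_inj n : injective (map_mx val : 'M[subsystemType]_n -> 'M[T]_n).
Proof.
move=> X Y /matrixP XY; apply/matrixP => i j; apply: val_inj.
by have := XY i j; rewrite !mxE.
Qed.

Lemma map_mx_val_star n (X : 'M[subsystemType]_n) :
  map_mx val (map_mx sub_star X)^T = (map_mx star (map_mx val X))^T.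
Proof. by apply/matrixP => i j; rewrite !mxE. Qed.

Lemma map_mx_val0 n : map_mx val (0 : 'M[subsystemType]_n) = 0.
Proof. by apply/matrixP => i j; rewrite !mxE. Qed.

Lemma map_mx_valD n (X Y : 'M[subsystemType]_n) :
  map_mx val (X + Y) = map_mx val X + map_mx val Y.
Proof. by apply/matrixP => i j; rewrite !mxE. Qed.

Lemma map_mx_valN n (X : 'M[subsystemType]_n) :
  map_mx val (- X) = - map_mx val X.
Proof. by apply/matrixP => i j; rewrite !mxE. Qed.

Lemma map_mx_val_unit n (r : R[i]) :
  map_mx val ((r *: sub_unit)%:M : 'M[subsystemType]_n) = (r *: ounit)%:M.
Proof. by apply/matrixP => i j; rewrite !mxE; case: eqP. Qed.

Lemma sub_mpos_herm n (X : 'M[subsystemType]_n) :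
  sub_mpos X -> (map_mx sub_star X)^T = X.
Proof.
by move=> X0; apply: map_mx_val_inj; rewrite map_mx_val_star mpos_herm.
Qed.

Lemma sub_mpos0 n : @sub_mpos n 0.
Proof. by rewrite /sub_mpos map_mx_val0; exact: mpos0. Qed.

Lemma sub_mposD n (X Y : 'M[subsystemType]_n) :
  sub_mpos X -> sub_mpos Y -> sub_mpos (X + Y).
Proof. by rewrite /sub_mpos map_mx_valD; exact: mposD. Qed.

Lemma sub_mposZ n (a : R[i]) (X : 'M[subsystemType]_n) :
  0 <= a -> sub_mpos X -> sub_mpos (map_mx ( *:%R a) X).
Proof.
move=> a0 X0; rewrite /sub_mpos.
rewrite (_ : map_mx _ _ = map_mx ( *:%R a) (map_mx val X)); first exact: mposZ.
by apply/matrixP => i j; rewrite !mxE.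
Qed.

Lemma sub_mpos_proper n (X : 'M[subsystemType]_n) :
  sub_mpos X -> sub_mpos (- X) -> X = 0.
Proof.
rewrite /sub_mpos map_mx_valN => X0 NX0; apply: map_mx_val_inj.
by rewrite map_mx_val0; exact: mpos_proper.
Qed.

Lemma sub_mpos_compress n m (A : 'M[R[i]]_(n, m)) (X : 'M[subsystemType]_n) :
  sub_mpos X ->
  sub_mpos (\matrix_(i < m, j < m)
    \sum_(k < n) \sum_(l < n) ((A k i)^* * A l j) *: X k l).
Proof.
move=> X0; rewrite /sub_mpos.
have := mpos_compress _ _ A _ X0; congr (mpos _ _).
apply/matrixP => i j; rewrite !mxE raddf_sum; apply: eq_bigr => k _.
by rewrite [RHS]raddf_sum; apply: eq_bigr => l _; rewrite mxE.
Qed.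

Lemma sub_unit_order_unit n (X : 'M[subsystemType]_n) :
  (map_mx sub_star X)^T = X ->
  exists2 r : R[i], 0 < r & sub_mpos ((r *: sub_unit)%:M - X).
Proof.
move=> XX; have [|r r0 rX] := @ounit_order_unit _ _ _ (map_mx val X).
  by rewrite -map_mx_val_star XX.
by exists r; rewrite // /sub_mpos map_mx_valD map_mx_valN map_mx_val_unit.
Qed.

Lemma sub_unit_archimedean n (X : 'M[subsystemType]_n) :
  (forall r : R[i], 0 < r -> sub_mpos ((r *: sub_unit)%:M + X)) -> sub_mpos X.
Proof.
move=> X0; apply: ounit_archimedean => r /X0.
by rewrite /sub_mpos map_mx_valD map_mx_val_unit.
Qed.

HB.instance Definition _ := Lmodule_isOperatorSystem.Build R subsystemType
  sub_starK sub_star_semilinear sub_mpos_herm sub_mpos0 sub_mposD sub_mposZ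
  sub_mpos_proper sub_mpos_compress sub_unit_order_unit sub_unit_archimedean.

End Subsystem.

Coercion subsystemType : opSubsystem >-> Sortclass.

Section VonNeumann.
Variables (R : realType) (H : hilbertType R).
Local Open Scope classical_set_scope.

Definition commutant (A : set (boundedOp H)) : set (boundedOp H) :=
  [set S | forall T, A T -> forall x, S (T x) = T (S x)].

(* A selfadjoint set that equals its bicommutant is automatically a unital
   *-subalgebra of the bounded operators. *)
Record vonNeumannAlgebra := VonNeumannAlgebra {
  vonNeumann_pred : {pred boundedOp H};
  vonNeumann_star :
    {in vonNeumann_pred, forall T, star T \in vonNeumann_pred};
  vonNeumann_bicommutant :
    commutant (commutant [set` vonNeumann_pred]) = [set` vonNeumann_pred]
}.

Variable M : vonNeumannAlgebra.

Lemma mem_vonNeumannP T : T \in vonNeumann_pred M <->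
  commutant (commutant [set` vonNeumann_pred M]) T.
Proof. by rewrite vonNeumann_bicommutant. Qed.

Lemma vonNeumann_submod : submod_closed (vonNeumann_pred M).
Proof.
split=> [|a S T /mem_vonNeumannP MS /mem_vonNeumannP MT];
  apply/mem_vonNeumannP => U MU x.
  exact: esym (linear0 U).
change (a *: S (U x) + T (U x) = U (a *: S x + T x)).
by rewrite (MS U MU) (MT U MU); rewrite linearP.
Qed.

Lemma vonNeumann_unit : (ounit : boundedOp H) \in vonNeumann_pred M.
Proof. by apply/mem_vonNeumannP => U MU x. Qed.

Definition vonNeumann_subsystem : opSubsystem (boundedOp H) :=
  OpSubsystem vonNeumann_submod (@vonNeumann_star M) vonNeumann_unit.

Definition is_factor : Prop :=
  [set` vonNeumann_pred M] `&` commutant [set` vonNeumann_pred M] =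
  [set a *: ounit | a in [set: R[i]]].

End VonNeumann.

Coercion vonNeumann_subsystem : vonNeumannAlgebra >-> opSubsystem.

Section CompletelyPositive.
Variables (R : realType) (V W : operatorSystemType R).

Definition completely_positive (f : {linear V -> W}) : Prop :=
  forall n (X : 'M[V]_n), mpos n X -> mpos n (map_mx f X).

(* As 0 <= s <= 1 holds in R[i], the scalar s is real. *)
Definition pure_completely_positive (f : {linear V -> W}) : Prop :=
  completely_positive f /\
  forall g h : {linear V -> W},
    completely_positive g -> completely_positive h ->
    (forall x, g x + h x = f x) ->
    exists2 s : R[i], 0 <= s <= 1 &
      (forall x, g x = s *: f x) /\ (forall x, h x = (1 - s) *: f x).

End CompletelyPositive.

Definition injective_system (R : realType) (Q : operatorSystemType R) : Prop :=
  forall (T : operatorSystemType R) (S : opSubsystem T) (f : {linear S -> Q}),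
    completely_positive f ->
    exists2 F : {linear T -> Q},
      completely_positive F & forall x : S, F (val x) = f x.

(* Main.v *)
(* The completely positive extensions of phi to T, seen as families of real
   numbers Re <Phi(t) x, y>, form a set that is nonempty by injectivity of M and
   compact for pointwise convergence: Phi(1) = phi(1) is prescribed and controls
   each coefficient, and bounded sesquilinear forms are operators.  So this set
   has an extreme point Phi.  If Phi = g + h, purity of phi yields
   g = s phi and h = (1 - s) phi on S.  For 0 < s < 1, g / s and h / (1 - s) are
   extensions of phi with convex combination Phi, hence equal to Phi; for s = 0
   or s = 1, g or h kills the order unit and therefore vanishes. *)
Require Import Defs.
From HB Require Import structures.
From mathcomp Require Import all_boot all_order all_algebra.
From mathcomp Require Import complex.
From mathcomp Require Import all_classical all_reals topology normedtype derive.
From mathcomp Require Import ring lra.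

Set Implicit Arguments.
Unset Strict Implicit.
Unset Printing Implicit Defensive.

Import Order.TTheory GRing.Theory Num.Theory.
Import numFieldNormedType.Exports.

Local Open Scope ring_scope.

(** * Extreme points of a compact set with separating real coordinates *)

Section ExtremePoint.
Local Open Scope classical_set_scope.

(* A minimal closed face lies in a level set of every coordinate p j, for
   otherwise the points of the face minimizing p j form a smaller closed face.
   Zorn's lemma is applied to the open complements U of closed faces K `\` U. *)
Lemma compact_extreme_point (R : realType) (X : topologicalType) (J : Type)
    (p : J -> X -> R) (K : set X) :
  (forall j, continuous (p j)) -> compact K -> K !=set0 ->
  (forall a b, K a -> K b -> (forall j, p j a = p j b) -> a = b) ->
  exists2 a, K a & forall b c (s : R), K b -> K c -> 0 < s < 1 ->
    (forall j, p j a = s * p j b + (1 - s) * p j c) -> b = a.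
Proof.
move=> p_cts K_compact K_neq0 p_sep.
pose coface U := [/\ open U, K `\` U !=set0 &
  forall a b c (s : R), (K `\` U) a -> K b -> K c -> 0 < s < 1 ->
    (forall j, p j a = s * p j b + (1 - s) * p j c) -> ~ U b /\ ~ U c].
have [F F_coface F_chain|U [[U_open [a [Ka Ua]] U_face] U_max]] :=
    @Zorn_bigcup X coface.
  (* The empty chain is bounded by [set0], whose face is the nonempty set [K] itself. *)
  have [->|/set0P[U0 FU0]] := eqVneq F set0.
    rewrite bigcup_set0; split; [exact: open0|by rewrite setD0|].
    by move=> *; split.
  split; first by apply: bigcup_open => U /F_coface[].
    (* The faces of a nonempty chain generate a proper filter. Compactness of [K] gives it a cluster
       point, which no open [U] of the chain can contain. *)
    pose G := filter_from F (fun U => K `\` U).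
    have G_filter : ProperFilter G.
      apply: filter_from_proper => [|U /F_coface[]//].
      apply: filter_from_filter; first by exists U0.
      move=> U V FU FV; have [UV|VU] := F_chain _ _ FU FV.
        by exists V => // x [Kx Vx]; split; split=> // /UV.
      by exists U => // x [Kx Ux]; split; split=> // /VU.
    have GK : G K by exists U0 => // x [].
    have [q [Kq q_cluster]] := K_compact _ G_filter GK.
    exists q; split=> // -[U FU Uq].
    have [U_open _ _] := F_coface _ FU.
    have GU : G (K `\` U) by exists U.
    by have [x [[_ nUx] Ux]] := q_cluster _ _ GU (open_nbhs_nbhs (conj U_open Uq)).
  move=> a b c s [Ka Fa] Kb Kc s01 abc.
  have Ubc U : F U -> ~ U b /\ ~ U c.
    move=> FU; have [_ _ U_face] := F_coface _ FU.
    by apply: (U_face a b c s) => //; split=> // Ua; apply: Fa; exists U.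
  by split=> -[U /Ubc[]].
have UK_compact : compact (K `\` U).
  by rewrite setDE; apply: compact_closedI => //; exact: open_closedC.
have p_cst j x : (K `\` U) x -> exists m, forall y, (K `\` U) y -> p j y = m.
  move=> UKx.
  have p_within : {within K `\` U, continuous (p j)} by exact: continuous_subspaceT.
  have [y0 /set_mem[Ky0 Uy0] y0_min] :=
    compact_EVT_min (ex_intro _ x UKx) UK_compact p_within.
  exists (p j y0) => y [Ky Uy]; apply/eqP.
  rewrite eq_le y0_min ?andbT; last by rewrite inE.
  (* A point [y] of the face above the minimum would make [V] a strictly larger coface, against the
     maximality of [U]. *)
  rewrite leNgt; apply/negP => lt_y.
  pose V := U `|` [set z | p j y0 < p j z].
  have UV : U `<` V.
    by split=> [z Uz|VU]; [left|apply/Uy/VU; right].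
  apply: (U_max V UV); split.
  - apply: openU => //; apply: (@open_comp _ _ (p j) [set z | p j y0 < z]).
      by move=> z _; exact: p_cts.
    exact: open_gt.
  - by exists y0; split=> // -[//|/=]; rewrite ltxx.
  - move=> a' b c s [Ka' Va'] Kb Kc s01 abc.
    have UKa' : (K `\` U) a' by split=> // Ua'; apply: Va'; left.
    have [Ub Uc] := U_face _ _ _ _ UKa' Kb Kc s01 abc.
    have a'_le : p j a' <= p j y0.
      by rewrite leNgt; apply/negP => lt_a'; apply: Va'; right.
    have b_ge : p j y0 <= p j b by apply: y0_min; rewrite inE.
    have c_ge : p j y0 <= p j c by apply: y0_min; rewrite inE.
    (* Two numbers not below the minimum, whose average with positive weights does not exceed it,
       both equal it. *)
    move: a'_le; rewrite abc => a'_le; case/andP: s01 => s0 s1.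
    by split=> -[//|/= lt_m]; nra.
exists a => // b c s Kb Kc s01 abc.
have [Ub Uc] := U_face _ _ _ _ (conj Ka Ua) Kb Kc s01 abc.
apply: p_sep => // j; have [m pm] := p_cst j _ (conj Ka Ua).
by rewrite !pm.
Qed.

End ExtremePoint.

(** * Operators recovered from the real parts of their coefficients *)

Section RealForms.
Variables (R : realType) (H : hilbertType R).
Implicit Types (x y z : H) (T : boundedOp H).

Lemma Re_dotpC x y : complex.Re (dotp x y) = complex.Re (dotp y x).
Proof. by rewrite [in RHS]dotpC Defs.Re_conj. Qed.

Lemma Re_dotp_inj x y :
  (forall z, complex.Re (dotp z x) = complex.Re (dotp z y)) -> x = y.
Proof.
move=> xy; apply/eqP; rewrite -subr_eq0; apply/eqP/sqn0_eq0.
by rewrite /sqn dotpDr dotpNr ReD ReN xy subrr.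
Qed.

Lemma boundedOp_Re_eq (S T : boundedOp H) :
  (forall x y, complex.Re (dotp (S x) y) = complex.Re (dotp (T x) y)) -> S = T.
Proof.
move=> ST; apply: boundedOp_eq => x; apply: Re_dotp_inj => y.
by rewrite Re_dotpC ST Re_dotpC.
Qed.

(** Riesz representation in the variable [x] yields the adjoint of [T]. As [F] is real-valued, a
    complex scalar on [y] cannot be factored out; conjugate linearity is expressed by moving it to
    [x]. *)
Lemma boundedOp_Re_dotpP (F : H -> H -> R) (C : R) : 0 <= C ->
  (forall x z y, F (x + z) y = F x y + F z y) ->
  (forall (r : R) x y, F (real_complex R r *: x) y = r * F x y) ->
  (forall x y z, F x (y + z) = F x y + F x z) ->
  (forall (a : R[i]) x y, F x (a *: y) = F (a^* *: x) y) ->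
  (forall x y, F x y ^+ 2 <= C * sqn x * sqn y) ->
  exists T, forall x y, F x y = complex.Re (dotp (T x) y).
Proof.
move=> C0 FDl FZl FDr FZr FC.
have Fa (u v : R) x y : F ((u +i* v)%C *: x) y = u * F x y + v * F ('i%C *: x) y.
  rewrite -!FZl -FDl scalerA -scalerDl; congr (F (_ *: _) y).
  by apply/eqP; rewrite eq_complex /=; apply/andP; split; apply/eqP; ring.
(* Since Re <T(ix), y> = - Im <Tx, y>, this is the only possible value of <Tx, y>. *)
pose f y x : R[i] := (F x y +i* - F ('i%C *: x) y)%C.
have ex y : exists z, forall x, f y x = dotp x z.
  apply: (@riesz _ _ _ (C * sqn y)) => [[u v] x z|x]; last first.
    by rewrite /f /= mulrAC.
  apply/eqP; rewrite eq_complex /= scalerDr scalerA.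
  have -> : 'i%C * (u +i* v)%C = (- v +i* u)%C :> R[i].
    by apply/eqP; rewrite eq_complex /=; apply/andP; split; apply/eqP; ring.
  by rewrite !FDl (Fa u v) (Fa (- v) u); apply/andP; split; apply/eqP; ring.
have {ex}[S fS] := choice ex.
have FS x y : F x y = complex.Re (dotp x (S y)) by rewrite -fS.
have S_lin : linear S.
  move=> a y z; apply: Re_dotp_inj => x.
  by rewrite -FS FDr FZr !FS -ReD dotpDr dotpZr dotpZl.
suff Sb : S \in @boundedOp_pred R H.
  by exists (bopadj (BoundedOp Sb)) => x y; rewrite bopadjE' FS.
apply: (linear_sqn_boundedOp S_lin C0) => y.
(* At [x = S y] the form takes the value [sqn (S y)], so cancelling one factor in its bound shows
   that [S] is bounded. *)
have Sy : sqn (S y) ^+ 2 <= C * sqn (S y) * sqn y by have := FC (S y) y; rewrite FS.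
have [y0|y0] := ltP 0 (sqn (S y)); last first.
  by rewrite (le_trans y0)// mulr_ge0// sqn_ge0.
by rewrite -(ler_pM2l y0) -expr2 mulrCA mulrA.
Qed.

Lemma Re_sum I (r : seq I) (P : pred I) (F : I -> R[i]) :
  complex.Re (\sum_(i <- r | P i) F i) = \sum_(i <- r | P i) complex.Re (F i).
Proof. by elim/big_rec2: _ => // i u v _ <-; rewrite ReD. Qed.

(** Expanding 0 <= |Ax - x|^2 gives 2 Re <Ax, x> <= |Ax|^2 + |x|^2. *)
Lemma Re_dotp_self_le (A : boundedOp H) : exists2 C : R, 0 <= C &
  forall x, complex.Re (dotp (A x) x) <= C * sqn x.
Proof.
have [K K0 AK] := boundedOp_sqn_le A.
exists (K + 1) => [|x]; first by rewrite addr_ge0.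
have := AK x; have := sqn_ge0 (A x); have := sqn_ge0 x.
have := sqn_ge0 (A x - x); rewrite sqnD sqnN dotpNr ReN; lra.
Qed.

End RealForms.

(** * Involution, positivity and coefficient bounds in systems of operators *)

Section Star.
Variables (R : realType) (V : operatorSystemType R).

Lemma star0 : star (0 : V) = 0.
Proof.
have := star_semilinear 1 (0 : V) 0; rewrite scaler0 addr0 => /eqP.
by rewrite conjC1 scale1r -subr_eq subrr eq_sym => /eqP.
Qed.

Lemma starN (v : V) : star (- v) = - star v.
Proof.
have := star_semilinear (-1) v 0.
by rewrite star0 !addr0 conjCN1 !scaleN1r.
Qed.

End Star.

Section SubsystemOfOperators.
Variables (R : realType) (H : hilbertType R) (N : opSubsystem (boundedOp H)).
Implicit Types (x y : H) (u v : N).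

Lemma Re_dotp_valD u v x y : complex.Re (dotp (val (u + v) x) y) =
  complex.Re (dotp (val u x) y) + complex.Re (dotp (val v x) y).
Proof. by rewrite raddfD boundedOpDE dotpDl ReD. Qed.

Lemma Re_dotp_valN u x y : complex.Re (dotp (val (- u) x) y) =
  - complex.Re (dotp (val u x) y).
Proof. by rewrite raddfN boundedOpNE dotpNl ReN. Qed.

Lemma Re_dotp_valZ (r : R) u x y :
  complex.Re (dotp (val (real_complex R r *: u) x) y) =
  r * complex.Re (dotp (val u x) y).
Proof.
rewrite (_ : val _ = real_complex R r *: val u :> boundedOp H) //.
by rewrite boundedOpZE dotpZl ReZ.
Qed.

Lemma Re_dotp_val_star u x y : complex.Re (dotp (val (star u) x) y) =
  complex.Re (dotp (val u y) x).
Proof. by rewrite [RHS]Re_dotpC -bopadjE'. Qed.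

Lemma Re_dotp_val_inj u v :
  (forall x y, complex.Re (dotp (val u x) y) = complex.Re (dotp (val v x) y)) ->
  u = v.
Proof. by move=> uv; apply/val_inj/boundedOp_Re_eq. Qed.

Lemma mpos_subsystemP n (X : 'M[N]_n) : mpos n X <->
  forall w : 'I_n -> H, 0 <= \sum_i \sum_j dotp (val (X i j) (w j)) (w i).
Proof.
by split=> X0 w; have := X0 w; congr (0 <= _); apply: eq_bigr => i _;
  apply: eq_bigr => j _; rewrite mxE.
Qed.

Variable T : operatorSystemType R.
Implicit Types (t : T) (Phi : {linear T -> N}).

(* The order unit gives r > 0 with [[r, -t], [-t^*, r]] positive; the image of
   this matrix is evaluated at the vectors (y, x) and (y, -x). *)
Lemma cp_Re_dotp_le t : exists2 r : R, 0 <= r &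
  forall Phi, completely_positive Phi -> forall x y,
    `|complex.Re (dotp (val (Phi t) x) y)| <=
      r * (complex.Re (dotp (val (Phi ounit) x) x) +
           complex.Re (dotp (val (Phi ounit) y) y)).
Proof.
pose X : 'M[T]_2 := \matrix_(i, j)
  (if i == j then 0 else if i == 0 then t else star t).
have XX : (map_mx star X)^T = X.
  apply/matrixP => i j; rewrite !mxE eq_sym; case: eqVneq => [_|ij].
    exact: star0.
  by move: i j ij => [[|[|//]] ?] [[|[|//]] ?] //= _; rewrite starK.
have [r r0 rX] := ounit_order_unit _ X XX.
have rE := ge0_ReE (ltW r0); set q := complex.Re r in rE.
have q0 : 0 <= q by rewrite -(@lecR R) -rE ltW.
exists (q / 2) => [|Phi Phi_cp x y]; first by rewrite divr_ge0.
have PhiX := Phi_cp _ _ rX.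
(* Positive matrices are hermitian; this is read off the off-diagonal entries of the image
   matrix. *)
have Phit : Phi (star t) = star (Phi t).
  have /matrixP/(_ 1 0) := mpos_herm _ _ PhiX.
  by rewrite !mxE /= !mulr0n !sub0r !raddfN /= starN => /oppr_inj.
have Phi_le z : 2 * complex.Re (dotp (val (Phi t) z) y) <=
    q * (complex.Re (dotp (val (Phi ounit) z) z) +
           complex.Re (dotp (val (Phi ounit) y) y)).
  have /mpos_subsystemP/(_ (fun i => if i == 0 then y else z)) := PhiX.
  rewrite !big_ord_recl !big_ord0 !mxE /= !mulr0n !mulr1n !sub0r !subr0 !addr0.
  rewrite rE !linearN !linearZ /= lecE /= => /andP[_].
  rewrite !ReD !Re_dotp_valN !Re_dotp_valZ.
  by rewrite Phit Re_dotp_val_star; lra.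
have := Phi_le x; have := Phi_le (- x).
rewrite linearN dotpNl ReN (_ : dotp _ (- x) = dotp (val (Phi ounit) x) x).
  by rewrite ler_norml; lra.
by rewrite dotpNr linearN dotpNl opprK.
Qed.

End SubsystemOfOperators.

(** * Compactness of the set of completely positive extensions *)

Section CompactExtensions.
Variables (R : realType) (H : hilbertType R) (M : vonNeumannAlgebra H).
Variables (T : operatorSystemType R) (S : opSubsystem T).
Variable phi : {linear S -> M}.
Local Open Scope classical_set_scope.

(** Real parts lose no information: replacing x by ix recovers the imaginary parts. The type
    [{ptws T * H * H -> R}] carries the product topology. *)
Definition Re_coeff (Phi : {linear T -> M}) : {ptws T * H * H -> R} :=
  fun i => complex.Re (dotp (val (Phi i.1.1) i.1.2) i.2).

Definition cp_extensions : set {linear T -> M} :=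
  [set Phi | completely_positive Phi /\ forall x : S, Phi (val x) = phi x].

(** The coefficient bounds place the image in a product of segments, compact by Tychonoff. The image
    is closed because extensions are characterized by closed conditions, each on finitely many
    coefficients. *)
Lemma compact_cp_extensions : compact (Re_coeff @` cp_extensions).
Proof.
have [C C0 phi_le] := Re_dotp_self_le (val (phi ounit)).
have /choice[r rP] t := iffLR (exists2P _ _) (@cp_Re_dotp_le R H M T t).
pose c t := r t * C.
have c0 t : 0 <= c t by rewrite mulr_ge0//; case: (rP t).
pose b (i : T * H * H) := c i.1.1 * (sqn i.1.2 + sqn i.2).
have Phi_b Phi i : cp_extensions Phi -> `[- b i, b i] (Re_coeff Phi i).
  move=> [Phi_cp Phi_phi]; case: i => -[t x] y.
  rewrite /= in_itv /= -ler_norml /Re_coeff /=.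
  have [r0 /(_ Phi Phi_cp x y)/le_trans] := rP t; apply.
  rewrite /b /c -mulrA ler_wpM2l// mulrDr.
  rewrite (_ : Phi ounit = phi ounit); last by rewrite -Phi_phi.
  by rewrite lerD.
apply: (@subclosed_compact _ _ [set f : {ptws T * H * H -> R} |
    forall i, `[- b i, b i] (f i)]); last 2 first.
- apply: (@tychonoff _ (fun=> R) (fun i => `[- b i, b i])) => i.
  exact: segment_compact.
- by move=> _ [Phi Phi_ext <-] i; exact: Phi_b.
move=> f Kf.
have eval_cts i : continuous (fun g : {ptws T * H * H -> R} => g i).
  exact: (@proj_continuous _ (fun=> R) i).
have f_in (g : {ptws T * H * H -> R} -> R) (D : set R) : continuous g -> closed D ->
    (forall Phi, cp_extensions Phi -> D (g (Re_coeff Phi))) -> D (g f).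
  move=> g_cts D_closed gD.
  have gD_closed : closed (g @^-1` D) by apply: closed_comp => // x _; exact: g_cts.
  by apply: gD_closed; apply: closureS Kf => _ [Phi /gD Phi_ext <-].
have f_eq i j k u v w : (forall Phi, cp_extensions Phi ->
      Re_coeff Phi i = u * Re_coeff Phi j + v * Re_coeff Phi k + w) ->
    f i = u * f j + v * f k + w.
  move=> Phi_eq; apply/eqP; rewrite -subr_eq0; apply/eqP.
  apply: (f_in (fun g => g i - (u * g j + v * g k + w)) [set z | z = 0]).
  - move=> g; apply: (@cvgB R R _ (nbhs g)); first exact: eval_cts.
    apply: (@cvgD R R _ (nbhs g)); last exact: cvg_cst.
    by apply: (@cvgD R R _ (nbhs g)); apply: (@cvgM R _ (nbhs g));
      (exact: cvg_cst || exact: eval_cts).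
  - exact: closed_eq.
  - by move=> Phi /Phi_eq <-; rewrite /= subrr.
have fDl t x z y : f (t, x + z, y) = f (t, x, y) + f (t, z, y).
  rewrite (f_eq _ (t, x, y) (t, z, y) 1 1 0) ?mul1r ?addr0// => Phi _.
  by rewrite /Re_coeff /= !mul1r addr0 linearD dotpDl ReD.
have fZl t s x y : f (t, real_complex R s *: x, y) = s * f (t, x, y).
  rewrite (f_eq _ (t, x, y) (t, x, y) s 0 0) ?mul0r ?addr0// => Phi _.
  by rewrite /Re_coeff /= mul0r !addr0 linearZ dotpZl ReZ.
have fDr t x y z : f (t, x, y + z) = f (t, x, y) + f (t, x, z).
  rewrite (f_eq _ (t, x, y) (t, x, z) 1 1 0) ?mul1r ?addr0// => Phi _.
  by rewrite /Re_coeff /= !mul1r addr0 dotpDr ReD.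
have fZr t a x y : f (t, x, a *: y) = f (t, a^* *: x, y).
  rewrite (f_eq _ (t, a^* *: x, y) (t, x, y) 1 0 0) ?mul1r ?mul0r ?addr0// => Phi _.
  by rewrite /Re_coeff /= mul1r mul0r !addr0 dotpZr linearZ dotpZl.
have f_lin a t s x y : f (a *: t + s, x, y) = f (t, a *: x, y) + f (s, x, y).
  rewrite (f_eq _ (t, a *: x, y) (s, x, y) 1 1 0) ?mul1r ?addr0// => Phi _.
  rewrite /Re_coeff /= !mul1r addr0 linearP Re_dotp_valD.
  by rewrite [val (Phi t) _]linearZ.
have f_commutant t U x y : commutant [set` vonNeumann_pred M] U ->
    f (t, U x, y) = f (t, x, bopadj U y).
  move=> MU; rewrite (f_eq _ (t, x, bopadj U y) (t, x, y) 1 0 0);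
    rewrite ?mul1r ?mul0r ?addr0// => Phi _.
  rewrite /Re_coeff /= mul1r mul0r !addr0 -bopadjE (MU (val (Phi t)))//.
  exact: valP (Phi t).
have f_phi (s : S) x y : f (val s, x, y) = complex.Re (dotp (val (phi s) x) y).
  rewrite (f_eq _ (val s, x, y) (val s, x, y) 0 0
    (complex.Re (dotp (val (phi s) x) y))) ?mul0r ?add0r// => Phi [_ Phi_phi].
  by rewrite /Re_coeff /= Phi_phi !mul0r !add0r.
have f_b i : `[- b i, b i] (f i).
  apply: (f_in (fun g => g i)) => //; first exact: interval_closed.
  by move=> Phi; exact: Phi_b.
(* The bound by a sum of squared norms becomes a product bound: replace [y] by its real multiples
   [s y] and take the discriminant in [s]. *)
have f_sqr t x y : f (t, x, y) ^+ 2 <= (2 * c t) ^+ 2 * sqn x * sqn y.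
  rewrite (_ : _ * sqn x * sqn y = 2 * c t * sqn x * (2 * c t * sqn y)); last by ring.
  apply: discr_le => [|s]; first by apply: mulr_ge0; [exact: mulr_ge0|exact: sqn_ge0].
  have := f_b (t, x, real_complex R s *: y).
  rewrite /= in_itv /= /b /= sqnZ fZr conj_Creal; last first.
    by apply/complex_realP; exists s.
  by rewrite fZl => /andP[] *; nra.
have [Op OpE] : exists Op : T -> boundedOp H,
    forall t x y, f (t, x, y) = complex.Re (dotp (Op t x) y).
  suff /choice[Op OpE] : forall t, exists A : boundedOp H,
      forall x y, f (t, x, y) = complex.Re (dotp (A x) y) by exists Op.
  move=> t; apply: (@boundedOp_Re_dotpP _ _ (fun x y => f (t, x, y)) _ _
    (fDl t) (fZl t) (fDr t) (fZr t) (f_sqr t)).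
  exact: sqr_ge0.
(* By the bicommutant property it suffices that [Op t] commutes with the commutant of [M], which is
   a closed condition on coefficients. *)
have OpM t : Op t \in subsystem_pred (vonNeumann_subsystem M).
  apply/mem_vonNeumannP => U MU x; apply: Re_dotp_inj => y.
  rewrite Re_dotpC [RHS]Re_dotpC (bopadjE U) -!OpE.
  exact: f_commutant.
pose Psi t : M := SubsystemType (OpM t).
have Psi_lin : linear Psi.
  move=> a t s; apply: Re_dotp_val_inj => x y.
  rewrite Re_dotp_valD -OpE f_lin !OpE; congr (_ + _).
  by rewrite linearZ.
pose Phi : {linear T -> M} := HB.pack Psi (GRing.isLinear.Build R[i] T M _ Psi Psi_lin).
have Phi_coeff : Re_coeff Phi = f.
  by apply/funext => -[[t x] y]; rewrite /Re_coeff /= OpE.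
exists Phi => //; split; last first.
  by move=> s; apply: Re_dotp_val_inj => x y; rewrite -f_phi OpE.
move=> n X X0; apply/mpos_subsystemP => w.
pose form (Theta : {linear T -> M}) :=
  \sum_i \sum_j dotp (val (Theta (X i j)) (w j)) (w i).
(* The scalar 1 reads off the real part of the form and -i its imaginary part. Positivity in [R[i]]
   thus becomes two closed conditions, one inequality and one equation. *)
pose sum_at a (g : {ptws T * H * H -> R}) := \sum_i \sum_j g (X i j, a *: w j, w i).
have sum_at_form a Theta : sum_at a (Re_coeff Theta) = complex.Re (a * form Theta).
  rewrite /form mulr_sumr Re_sum; apply: eq_bigr => i _.
  rewrite mulr_sumr Re_sum; apply: eq_bigr => j _.
  by rewrite /Re_coeff /= linearZ dotpZl.
have sum_at_cts a : continuous (sum_at a).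
  apply: continuous_big => [|i _]; first exact: add_continuous.
  by apply: continuous_big => [|j _]; [exact: add_continuous|exact: eval_cts].
have formE (Theta : {linear T -> M}) :
    \sum_i \sum_j dotp (val (map_mx Theta X i j) (w j)) (w i) = form Theta.
  by apply: eq_bigr => i _; apply: eq_bigr => j _; rewrite mxE.
have form_ge0 Theta : cp_extensions Theta -> 0 <= form Theta.
  by move=> [/(_ _ _ X0)/mpos_subsystemP/(_ w) + _]; rewrite formE.
have Re_ge0 : 0 <= sum_at 1 f.
  apply: (f_in _ [set z | 0 <= z] (sum_at_cts 1)); first exact: closed_ge.
  by move=> Theta /form_ge0; rewrite sum_at_form mul1r lecE => /andP[].
have Im_eq0 : sum_at (- 'i%C) f = 0.
  apply: (f_in _ [set z | z = 0] (sum_at_cts _)); first exact: closed_eq.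
  move=> Theta /form_ge0; rewrite sum_at_form lecE => /andP[/eqP + _].
  by case: (form Theta) => u v /=; lra.
move: Re_ge0 Im_eq0; rewrite -Phi_coeff !sum_at_form mul1r formE lecE.
by case: (form Phi) => u v /= *; apply/andP; split; [apply/eqP|]; lra.
Qed.

End CompactExtensions.

(** * Vanishing, scaling and restriction of completely positive maps *)

Section CompletelyPositiveMaps.
Variables (R : realType) (H : hilbertType R) (N : opSubsystem (boundedOp H)).
Variable T : operatorSystemType R.
Implicit Types (f g h : {linear T -> N}).

(** By [cp_Re_dotp_le], the coefficients of [f ounit] bound those of every [f t]. *)
Lemma cp_ounit_eq0 f : completely_positive f -> f ounit = 0 -> forall t, f t = 0.
Proof.
move=> f_cp f1 t; have [r _ /(_ _ f_cp) f_le] := cp_Re_dotp_le N t.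
have Re0 x y : complex.Re (dotp (val (0 : N) x) y) = 0 by rewrite dotp0l.
apply: Re_dotp_val_inj => x y; apply/eqP; rewrite Re0 -normr_eq0.
by have := f_le x y; rewrite f1 !Re0 addr0 mulr0 normr_le0 normr_eq0.
Qed.

Lemma cp_scale (r : R) f : 0 <= r -> completely_positive f ->
  exists2 g, completely_positive g & forall t, g t = real_complex R r *: f t.
Proof.
move=> r0 f_cp; pose g t := real_complex R r *: f t.
have g_lin : linear g.
  by move=> a s t; rewrite /g linearP scalerDr !scalerA mulrC.
pose G : {linear T -> N} := HB.pack g (GRing.isLinear.Build R[i] T N _ g g_lin).
have rC0 : 0 <= real_complex R r by rewrite lecR.
exists G => // n X /f_cp /(mposZ _ _ _ rC0); congr (mpos _ _).
by apply/matrixP => i j; rewrite !mxE.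
Qed.

Lemma cp_restriction (S : opSubsystem T) f : completely_positive f ->
  exists2 g : {linear S -> N}, completely_positive g & forall x : S, g x = f (val x).
Proof.
move=> f_cp; pose g (x : S) := f (val x).
have g_lin : linear g by move=> a x y; rewrite /g linearP.
pose G : {linear S -> N} := HB.pack g (GRing.isLinear.Build R[i] S N _ g g_lin).
exists G => // n X /f_cp; congr (mpos _ _).
by apply/matrixP => i j; rewrite !mxE.
Qed.

End CompletelyPositiveMaps.

(** * Purity of an extreme extension *)

Theorem proposition2p15 (R : realType) (H : hilbertType R)
  (M : vonNeumannAlgebra H) (M_factor : is_factor M)
  (M_injective : injective_system M)
  (T : operatorSystemType R) (S : opSubsystem T) (phi : {linear S -> M})
  (phi_pure : pure_completely_positive phi) :
  exists2 Phi : {linear T -> M},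
    pure_completely_positive Phi & forall x : S, Phi (val x) = phi x.
Proof.
have [phi_cp phi_split] := phi_pure.
have [Phi0 Phi0_cp Phi0_phi] := M_injective _ _ _ phi_cp.
(* The coordinates are the evaluations at triples (t, x, y), which separate families of coefficients
   by extensionality. *)
have [||_ [Phi [Phi_cp Phi_phi] <-] Phi_extreme] := @compact_extreme_point R _ _
    (fun i (f : {ptws T * H * H -> R}) => f i) _
    (fun i => @proj_continuous _ (fun=> R) i) (compact_cp_extensions (phi := phi)).
- by exists (Re_coeff Phi0), Phi0.
- by move=> f g _ _ fg; apply/funext.
exists Phi => //; split=> // g h g_cp h_cp gh.
have [gS gS_cp gSE] := cp_restriction S g_cp.
have [hS hS_cp hSE] := cp_restriction S h_cp.
have [x|s /andP[s0 s1] [g_phi h_phi]] := phi_split _ _ gS_cp hS_cp.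
  by rewrite gSE hSE gh Phi_phi.
have gU : g ounit = s *: phi ounit by rewrite -g_phi gSE.
have hU : h ounit = (1 - s) *: phi ounit by rewrite -h_phi hSE.
have hE t : h t = Phi t - g t by rewrite -gh addrC addKr.
suff gE t : g t = s *: Phi t.
  exists s; first exact/andP.
  by split=> // t; rewrite hE gE scalerBl scale1r.
have [s_eq0|s_neq0] := eqVneq s 0.
  by rewrite s_eq0 scale0r; apply: cp_ounit_eq0; rewrite // gU s_eq0 scale0r.
have [s_eq1|s_neq1] := eqVneq s 1.
  have : h t = 0 by apply: cp_ounit_eq0; rewrite // hU s_eq1 subrr scale0r.
  by rewrite hE s_eq1 scale1r => /eqP; rewrite subr_eq0 => /eqP.
(* Purity provides a scalar in [R[i]], whereas extremality uses weights in [R]; being nonnegative,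
   [s] is its own real part. *)
have sE := ge0_ReE s0; set q := complex.Re s in sE.
have q0 : 0 < q by rewrite -(@ltcR R) -sE lt_def s_neq0.
have q1 : q < 1 by rewrite -(@ltcR R) -sE lt_neqAle s_neq1.
have qN1 : 0 < 1 - q by rewrite subr_gt0.
have [g' g'_cp g'E] := cp_scale (ltW (etrans (invr_gt0 q) q0)) g_cp.
have [h' h'_cp h'E] := cp_scale (ltW (etrans (invr_gt0 _) qN1)) h_cp.
have g'K : Re_coeff g' = Re_coeff Phi.
  apply: (Phi_extreme _ (Re_coeff h') q).
  - exists g' => //; split=> // x; rewrite g'E -gSE g_phi sE scalerA -rmorphM.
    by rewrite mulVf ?gt_eqF// scale1r.
  - exists h' => //; split=> // x; rewrite h'E -hSE h_phi sE -rmorphB scalerA -rmorphM.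
    by rewrite mulVf ?gt_eqF// scale1r.
  - by rewrite q0.
  - move=> -[[u x] y]; rewrite /Re_coeff /= g'E h'E !Re_dotp_valZ.
    by rewrite !mulVKf ?gt_eqF// -Re_dotp_valD gh.
have -> : Phi t = g' t.
  by apply: Re_dotp_val_inj => x y; have /(congr1 (@^~ (t, x, y))) := g'K.
by rewrite g'E sE scalerA -rmorphM mulfV ?gt_eqF// scale1r.
Qed.
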